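(* Let $T\in\mathbb N$, $0\le\lambda\le1$, and let $0=s_0<s_1<\cdots$ be a partition of the positive real line into $B_j=(s_{j-1},s_j]$, $j\in\mathbb N$, with $a_j=|B_j|$ and $|B_j|=|B_{j+kT}|$ for $k\in\mathbb N$. Let $\{X^p_j,\ j\in\mathbb N\}$ be a positive second order discrete time periodically correlated process with period $T$ on a probability space $(\Omega,\mathcal F,P)$, and let $\gamma^p_{jk}=\operatorname{cov}(X^p_j,X^p_k)$. Then there exist second order random measures $M_j$ on the Borel subsets of $B_j$, $j\in\mathbb N$, such that $M_j(B_j)=X^p_j$, $E[M_j(A)]=\frac{|A|}{|B_j|}E[X^p_j]$ for $A\subset B_j$, and for $A,B\subset B_j$ and $D\subset B_k$ with $k\neq j$ $$\operatorname{cov}\big(M_j(A),M_j(B)\big)=\frac{\lambda|A||B|+(1-\lambda)a_j|A\cap B|}{a_j^2}\,\gamma^p_{jj},\qquad \operatorname{cov}\big(M_j(A),M_k(D)\big)=\frac{|A||D|}{a_ja_k}\,\gamma^p_{jk}.$$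
   Context: $|A|$ denotes Lebesgue measure, $\mathbb N=\{1,2,\dots\}$, and the sets $A,B,D$ are Borel. A second order sequence $\{X^p_j\}$ is periodically correlated with period $T$ if $E[X^p_{j+T}]=E[X^p_j]$ and $\operatorname{cov}(X^p_{j+T},X^p_{k+T})=\operatorname{cov}(X^p_j,X^p_k)$ for all $j,k$. Given a measurable space $(D,\mathcal D)$ and the Hilbert space $\mathcal L^2(\Omega,\mathcal F,P)$ of real random variables on $(\Omega,\mathcal F,P)$ with finite second moment, a second order random measure on $\mathcal D$ is a mapping $\Phi:\mathcal D\to\mathcal L^2(\Omega,\mathcal F,P)$ with $\Phi(\emptyset)=0$ and $E\big|\Phi(\bigcup_{i=1}^\infty A_i)-\sum_{i=1}^n\Phi(A_i)\big|^2\to0$ as $n\to\infty$ for disjoint sets $A_1,A_2,\ldots\in\mathcal D$.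
   Formalization: The random measures M_j are constructed on an extension of (Ω,F,P), with X^p_j lifted to it and M_j(B_j)=X^p_j almost surely there; on the given (Ω,F,P) they need not exist, e.g. when Ω is finite, λ<1 and X^p_j is nonconstant. *)

(* Defs.v *)
From HB Require Import structures.
From mathcomp Require Import all_boot all_order all_algebra.
From mathcomp Require Import all_classical all_reals all_analysis.
Set Implicit Arguments.
Unset Strict Implicit.
Unset Printing Implicit Defensive.
Import Order.TTheory GRing.Theory Num.Theory.
Import numFieldNormedType.Exports.

Local Open Scope classical_set_scope.
Local Open Scope ring_scope.

(* Sequences of the form (u_j), j = 1, 2, ..., are functions on nat all of whose
   hypotheses and conclusions are restricted to indices j > 0; the value at
   j = 0 is never used. *)

(* |A| as a real number; it is only applied to sets of finite measure, on which
   fine loses nothing. *)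
Definition leb (R : realType) (A : set R) : R := fine (lebesgue_measure A).

Definition block (R : realType) (s : nat -> R) (j : nat) : set R :=
  [set` `]s j.-1, s j]].

Definition borel_on (R : realType) (B : set R) : set (set R) :=
  [set A | measurable A /\ A `<=` B].

Lemma sigma_algebra_borel_on (R : realType) (B : set R) :
  measurable B -> sigma_algebra B (borel_on B).
Proof.
move=> mB; split.
- by split; [exact: measurable0|exact: sub0set].
- by move=> A [mA _]; split; [exact: measurableD|exact: subDsetl].
- move=> F mF; split; first by apply: bigcup_measurable => k _; have [] := mF k.
  by apply: bigcup_sub => k _; have [] := mF k.
Qed.

(* The elements of L^2(P) are represented by functions, so that equality in
   L^2(P) is equality P-almost everywhere. The family A is indexed from 0, and
   the partial sum ranges over its first n terms. *)
Definition second_order_random_measure (S : Type) (F : set (set S))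
    (d : measure_display) (Omega : measurableType d) (R : realType)
    (P : probability Omega R) (Phi : set S -> Omega -> R) : Prop :=
  [/\ forall A, F A -> Phi A \in Lfun P 2%:E,
      {ae P, forall w, Phi set0 w = 0} &
      forall A : nat -> set S, (forall i, F (A i)) -> trivIset setT A ->
        'E_P[fun w => (`|Phi (\bigcup_i A i) w - \sum_(i < n) Phi (A i) w| ^+ 2)%R]%E
          @[n --> \oo] --> 0%E].

Definition second_order_process (d : measure_display) (Omega : measurableType d)
    (R : realType) (P : probability Omega R) (X : nat -> Omega -> R) : Prop :=
  forall j, (0 < j)%N -> X j \in Lfun P 2%:E.

Definition positive_process (d : measure_display) (Omega : measurableType d)
    (R : realType) (P : probability Omega R) (X : nat -> Omega -> R) : Prop :=
  forall j, (0 < j)%N -> {ae P, forall w, 0 < X j w}.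

Definition periodically_correlated (d : measure_display)
    (Omega : measurableType d) (R : realType) (P : probability Omega R)
    (T : nat) (X : nat -> Omega -> R) : Prop :=
  (forall j, (0 < j)%N -> 'E_P[X (j + T)%N] = 'E_P[X j])%E /\
  (forall j k, (0 < j)%N -> (0 < k)%N ->
    covariance P (X (j + T)%N) (X (k + T)%N) = covariance P (X j) (X k)).

(* (Omega', P') extends (Omega, P) along p: random variables X on Omega are
   identified with X \o p, which has the same joint laws. On a fixed Omega the
   random measures need not exist: when lambda < 1 and X_j is not constant they
   force L^2(P) to be infinite-dimensional, which fails for finite Omega. *)
Definition probability_extension (R : realType)
    (d : measure_display) (Omega : measurableType d) (P : probability Omega R)
    (d' : measure_display) (Omega' : measurableType d')
    (P' : probability Omega' R) (p : Omega' -> Omega) : Prop :=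
  measurable_fun setT p /\
  forall A, measurable A -> P' (p @^-1` A) = P A.

(* Main.v *)
Require Import Defs.
From HB Require Import structures.
From mathcomp Require Import all_boot all_order all_algebra.
From mathcomp Require Import all_classical all_reals all_analysis.
From mathcomp Require Import measurable_realfun ring lra.
Import Order.TTheory GRing.Theory Num.Theory.
Import numFieldNormedType.Exports.
Local Open Scope classical_set_scope.
Local Open Scope ring_scope.

(** Write [a_j = |B_j|].  On [Omega * R] with the product of [P] and a
    probability [mu] that is uniform on each block (with mass [2 ^- j] on
    [B_j]), take [X_j] on the first factor, the uniform point [u] on the second,
    and put
      [M_j(A) = |A| / a_j X_j + c_j (1_A(u) - |A| / a_j 1_(B_j)(u))].
    The second summand is the fluctuation of an empirical measure: it is
    centred, vanishes at [A = B_j], is uncorrelated with all functions on the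
    first factor, and summands of different blocks have disjoint supports.  Its
    covariance is [c_j ^ 2 mu(B_j) (|A & A'| / a_j - |A| |A'| / a_j ^ 2)], so
    [c_j ^ 2 = (1 - lambda) gamma_jj / mu(B_j)] gives the required mixture. *)

(** * Square-integrable functions and bilinearity of covariance *)

Section square_integrable.
Context {d : measure_display} {S : measurableType d} {R : realType}.
Context {P : probability S R}.

Lemma measurable_Lfun {p} {f : S -> R} :
  f \in Lfun P p -> measurable_fun setT f.
Proof. by rewrite inE => /andP[]; rewrite inE. Qed.

Lemma Lfun_indic {A : set S} {r : R} : measurable A -> \1_A \in Lfun P r%:E.
Proof.
move=> mA; rewrite inE; apply/andP; split; rewrite inE/=.
  exact: measurable_indic.
rewrite /finite_norm unlock poweR_lty//.
apply: (@le_lt_trans _ _ (\int[P]_x (cst 1 x))%E); last first.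
  rewrite integral_cst// mul1e.
  by rewrite ltey_eq fin_num_measure.
apply: ge0_le_integral => //.
- by move=> x _; rewrite lee_fin powR_ge0.
- apply/measurable_EFinP.
  apply: (@measurableT_comp _ _ _ _ _ _ (@powR R ^~ r)) => //.
  by apply: measurableT_comp => //; exact: measurable_indic.
- move=> x _; rewrite lee_fin ger0_norm// indicE.
  (* Off [A] the integrand is [0] to the power [r], which is 1 for [r = 0] and 0 otherwise by
     convention; both values are at most 1. *)
  by case: (_ \in _); rewrite ?powR1// /powR eqxx; case: (_ == _).
Qed.

Lemma Lfun21 {f : S -> R} : f \in Lfun P 2%:E -> f \in Lfun P 1.
Proof. by apply: Lfun_subset12; rewrite fin_num_measure. Qed.

Lemma covarianceE2 {f g : S -> R} : f \in Lfun P 2%:E -> g \in Lfun P 2%:E ->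
  (covariance P f g = 'E_P[f \* g] - 'E_P[f] * 'E_P[g])%E.
Proof.
by move=> f2 g2; rewrite covarianceE//; [exact: Lfun21|exact: Lfun21|
  exact: Lfun2_mul_Lfun1].
Qed.

Lemma covariance_fin2 {f g : S -> R} :
  f \in Lfun P 2%:E -> g \in Lfun P 2%:E -> covariance P f g \is a fin_num.
Proof.
by move=> f2 g2; rewrite covariance_fin_num ?Lfun2_mul_Lfun1 ?Lfun21.
Qed.

Lemma Lfun2_scale {f : S -> R} (b : R) :
  f \in Lfun P 2%:E -> b \o* f \in Lfun P 2%:E.
Proof. by move=> f2; rewrite Lfun_scale// ler1n. Qed.

Lemma Lfun2B {f g : S -> R} :
  f \in Lfun P 2%:E -> g \in Lfun P 2%:E -> f \- g \in Lfun P 2%:E.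
Proof.
by move=> f2 g2; rewrite -[f \- g]/(f - g) rpredB//= ?lee_fin ?ler1n.
Qed.

Lemma Lfun1B {f g : S -> R} :
  f \in Lfun P 1 -> g \in Lfun P 1 -> f \- g \in Lfun P 1.
Proof. by move=> f1 g1; rewrite -[f \- g]/(f - g) rpredB. Qed.

Lemma Lfun_lincomb {Z W : S -> R} (a c : R) :
  Z \in Lfun P 2%:E -> W \in Lfun P 2%:E ->
  a \o* Z \+ c \o* W \in Lfun P 2%:E.
Proof.
move=> Z2 W2; rewrite -[_ \+ _]/((a \o* Z) + (c \o* W)).
by rewrite rpredD//= ?Lfun2_scale// ?lee_fin ?ler1n.
Qed.

Lemma covarianceZ {f g : S -> R} (a b : R) :
  f \in Lfun P 2%:E -> g \in Lfun P 2%:E ->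
  covariance P (a \o* f) (b \o* g) = ((a * b)%:E * covariance P f g)%E.
Proof.
move=> f2 g2; have bg2 := Lfun2_scale b g2.
rewrite (covarianceZl a (Lfun21 f2) (Lfun21 bg2) (Lfun2_mul_Lfun1 f2 bg2)).
rewrite (covarianceZr b (Lfun21 f2) (Lfun21 g2) (Lfun2_mul_Lfun1 f2 g2)).
by rewrite muleA EFinM.
Qed.

(** Bilinearity gives four terms, and the two mixed ones vanish. [Z] and [Z'] will depend on the
    first factor, [W] and [W'] on the second, so the two sources of randomness contribute
    separately. *)
Lemma covariance_lincomb {Z W Z' W' : S -> R} (a c a' c' : R) :
  Z \in Lfun P 2%:E -> W \in Lfun P 2%:E ->
  Z' \in Lfun P 2%:E -> W' \in Lfun P 2%:E ->
  covariance P Z W' = 0%E -> covariance P Z' W = 0%E ->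
  covariance P (a \o* Z \+ c \o* W) (a' \o* Z' \+ c' \o* W') =
  ((a * a')%:E * covariance P Z Z' + (c * c')%:E * covariance P W W')%E.
Proof.
move=> Z2 W2 Z2' W2' ZW' Z'W.
rewrite covarianceDl ?Lfun_lincomb ?Lfun2_scale//.
rewrite !covarianceDr ?Lfun2_scale// !covarianceZ//.
by rewrite ZW' (covarianceC _ W Z') Z'W !mule0 add0e adde0.
Qed.

End square_integrable.

(** * Invariance of moments under an extension of the probability space *)

Section probability_extension.
Context {d d' : measure_display} {S : measurableType d} {S' : measurableType d'}.
Context {R : realType} {P : probability S R} {P' : probability S' R}.
Context {p : S' -> S} (Pp : probability_extension P P' p).

(** The image of [P'] under [p] is [P], so composing with [p] does not change the integral of
    [|f|^r]. *)
Lemma Lfun_comp {f : S -> R} {r : R} :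
  f \in Lfun P r%:E -> f \o p \in Lfun P' r%:E.
Proof.
case: Pp => mp P'p fr; have mf := measurable_Lfun fr.
move: fr; rewrite !inE => /andP[_]; rewrite inE/= => nf.
apply/andP; split; rewrite inE/=; first exact: measurableT_comp.
move: nf; rewrite /finite_norm unlock; congr (_ < _)%E; congr (_ `^ _)%E.
have mfr : measurable_fun setT (fun x => (`|f x| `^ r)%:E).
  apply/measurable_EFinP.
  apply: (@measurableT_comp _ _ _ _ _ _ (@powR R ^~ r)) => //.
  exact: measurableT_comp.
have := @ge0_integral_pushforward _ _ _ _ R p mp P' setT
  (fun x => (`|f x| `^ r)%:E) measurableT mfr.
rewrite preimage_setT => <-; last by move=> x _; rewrite lee_fin powR_ge0.
by apply: eq_measure_integral => A mA _; apply: esym; exact: P'p.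
Qed.

Lemma expectation_comp {f : S -> R} :
  f \in Lfun P 1 -> ('E_P'[f \o p] = 'E_P[f])%E.
Proof.
move=> f1; have [mp P'p] := Pp.
have /Lfun1_integrable fp1 := Lfun_comp f1.
have mf : measurable_fun setT (EFin \o f).
  by apply/measurable_EFinP; exact: measurable_Lfun f1.
have := @integral_pushforward _ _ _ _ R p mp P' setT (EFin \o f) mf.
rewrite preimage_setT => /(_ fp1 measurableT) h.
rewrite unlock; apply: (etrans (esym h)).
by apply: eq_measure_integral => A mA _; exact: P'p.
Qed.

Lemma covariance_comp {f g : S -> R} :
  f \in Lfun P 2%:E -> g \in Lfun P 2%:E ->
  covariance P' (f \o p) (g \o p) = covariance P f g.
Proof.
move=> f2 g2; rewrite !covarianceE2 ?Lfun_comp//.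
rewrite -(expectation_comp (Lfun2_mul_Lfun1 f2 g2)).
by rewrite (expectation_comp (Lfun21 f2)) (expectation_comp (Lfun21 g2)).
Qed.

End probability_extension.

(** * The product space as an extension of both factors *)

Section product_extension.
Context {d d' : measure_display} {S : measurableType d} {S' : measurableType d'}.
Context {R : realType} (P : probability S R) (mu : probability S' R).

Lemma probability_extension_fst : probability_extension P (P \x mu)%E fst.
Proof.
split=> [|A mA]; first exact: measurable_fst.
have -> : @fst S S' @^-1` A = A `*` setT.
  by apply/seteqP; split=> -[x y]// [].
apply: (etrans (product_measure1E P mu mA measurableT)).
by rewrite [X in (_ * X)%E]probability_setT mule1.
Qed.

Lemma probability_extension_snd : probability_extension mu (P \x mu)%E snd.
Proof.
split=> [|A mA]; first exact: measurable_snd.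
have -> : @snd S S' @^-1` A = setT `*` A.
  by apply/seteqP; split=> -[x y]// [].
apply: (etrans (product_measure1E P mu measurableT mA)).
by rewrite [X in (X * _)%E]probability_setT mul1e.
Qed.

(** Independence of the coordinates: Fubini factors the expectation of the product. Square
    integrability of both functions makes the product integrable on the product space, as Fubini
    requires. *)
Lemma covariance_fst_snd {f : S -> R} {g : S' -> R} :
  f \in Lfun P 2%:E -> g \in Lfun mu 2%:E ->
  covariance (P \x mu)%E (f \o fst) (g \o snd) = 0%E.
Proof.
move=> f2 g2.
have ext1 := probability_extension_fst; have ext2 := probability_extension_snd.
have f2' := Lfun_comp ext1 f2; have g2' := Lfun_comp ext2 g2.
rewrite covarianceE2// (expectation_comp ext1 (Lfun21 f2)).
rewrite (expectation_comp ext2 (Lfun21 g2)).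
have /Lfun1_integrable fg1 := Lfun2_mul_Lfun1 f2' g2'.
have /Lfun1_integrable f1 := Lfun21 f2; have /Lfun1_integrable g1 := Lfun21 g2.
have Ef := expectation_fin_num (Lfun21 f2).
have Eg := expectation_fin_num (Lfun21 g2).
suff -> : ('E_(P \x mu)%E[(f \o fst) \* (g \o snd)] = 'E_P[f] * 'E_mu[g])%E.
  by rewrite subee// fin_numM.
have EfE : 'E_P[f]%E = (\int[P]_x (f x)%:E)%E by rewrite unlock.
have EgE : 'E_mu[g]%E = (\int[mu]_y (g y)%:E)%E by rewrite unlock.
transitivity (\int[P \x mu]_z (f z.1 * g z.2)%:E)%E; first by rewrite unlock.
rewrite -integral12_prod_meas1// /fubini_F/=.
rewrite -(fineK Eg) EfE -integralZr//.
apply: eq_integral => x _.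
under eq_integral do rewrite EFinM.
by rewrite integralZl//= fineK// EgE.
Qed.

End product_extension.

(** The measure is the mixture of the normalised restrictions of [m] to the [B k] with weights
    [2 ^- k.+1]. Inside one block only one component is nonzero, so there the mixture is a multiple
    of [m]. *)
Lemma exists_blockwise_probability (d : measure_display) (S : measurableType d)
    (R : realType) (m : {measure set S -> \bar R}) (B : nat -> set S) :
  (forall k, measurable (B k)) -> trivIset setT B ->
  (forall k, 0 < m (B k) < +oo)%E ->
  exists mu : probability S R, forall k A, measurable A -> A `<=` B k ->
    mu A = ((1 / (2 ^ k.+1)%:R / fine (m (B k)))%:E * m A)%E.
Proof.
move=> mB tB mB0.
have fB k : m (B k) \is a fin_num.
  by have /andP[? ?] := mB0 k; rewrite ge0_fin_numE// ltW.
have fB0 k : 0 < fine (m (B k)) by apply: fine_gt0.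
have q0 k : 0 <= 1 / (2 ^ k.+1)%:R / fine (m (B k)) :> R.
  by rewrite !divr_ge0// ltW.
pose part k := mscale (NngNum (q0 k)) (mrestr m (mB k)).
pose nu := mseries part 0.
have nuT : nu setT = 1%E.
  rewrite /nu/= /mseries.
  (* Component [k] has total mass [1 / 2 ^ k.+1], so the masses form a geometric series with sum
     1. *)
  have := @cvg_geometric_eseries_half R 1 0; rewrite expr0 divr1 => /cvg_lim <-//.
  congr (limn _); apply/funext => n; apply: eq_bigr => k _.
  rewrite /part/= /mscale/= /mrestr setTI -[m (B k)]fineK// -EFinM addn1.
  by rewrite divfK ?gt_eqF ?fB0.
pose mu : probability S R :=
  HB.pack_for (probability S R) nu (Measure_isProbability.Build _ _ _ nu nuT).
exists mu => k A mA AB; rewrite [LHS]/(mseries part 0 A) /mseries.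
rewrite (nneseriesD1 (n := k))//.
(* For [i != k] the set [A], lying in [B k], misses [B i]; only component [k] remains. *)
rewrite eseries0 ?adde0; last first.
  move=> i _ /andP[_ ik]; rewrite /part/= /mscale/= /mrestr.
  rewrite (_ : A `&` B i = set0) ?measure0 ?mule0//.
  apply/seteqP; split=> // x [Ax Bix].
  by move/eqP: ik; apply; apply: tB => //; exists x; split => //; exact: AB.
by rewrite /part/= /mscale/= /mrestr (setIidl AB).
Qed.

(** * Measure and disjointness of the blocks *)

Section block.
Context {R : realType} {s : nat -> R} (s_incr : forall j, s j < s j.+1).

Lemma measurable_block j : measurable (block s j).
Proof. exact: measurable_itv. Qed.

(** At [j = 0] the truncated predecessor would give the empty interval []s 0, s 0]], hence the
    positive index. *)
Lemma lebesgue_block j : (0 < j)%N ->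
  (0 < lebesgue_measure (block s j) < +oo)%E.
Proof.
case: j => // j _; rewrite /block lebesgue_measure_itv/= lte_fin s_incr.
by rewrite -EFinB lte_fin subr_gt0 s_incr ltry.
Qed.

Lemma block_disjoint j k : (0 < j)%N -> (0 < k)%N -> k != j ->
  block s j `&` block s k = set0.
Proof.
move=> j0 k0; wlog jk : j k j0 k0 / (j < k)%N => [hw kj|_].
  move: (kj); rewrite neq_ltn => /orP[?|?]; last exact: hw.
  by rewrite setIC hw// eq_sym.
have smono : {homo s : m n / (m <= n)%N >-> m <= n}.
  by apply: homo_leq => [//|y x z|n]; [exact: le_trans|exact: ltW].
apply/seteqP; split=> // x []; rewrite /block /= !in_itv/= => /andP[_ xj] /andP[kx _].
(* Since [j < k] means [j <= k.-1], block [j] ends no later than block [k] starts. *)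
have : s j <= s k.-1 by apply: smono; rewrite -ltnS prednK.
by move=> /(le_trans xj) /le_lt_trans /(_ kx); rewrite ltxx.
Qed.

End block.

(** * Additive set functions on the Borel subsets of a set *)

Section borel_on.
Context {R : realType} {B : set R}.

Lemma borel_onU A A' : borel_on B A -> borel_on B A' -> borel_on B (A `|` A').
Proof.
by move=> [mA AB] [mA' AB']; split; [exact: measurableU|rewrite subUset].
Qed.

Lemma borel_onI A A' : borel_on B A -> borel_on B A' -> borel_on B (A `&` A').
Proof.
move=> [mA AB] [mA' _]; split; first exact: measurableI.
by move=> x [/AB].
Qed.

Lemma borel_onD A A' : borel_on B A -> borel_on B A' -> borel_on B (A `\` A').
Proof.
move=> [mA AB] [mA' _]; split; first exact: measurableD.
by move=> x [/AB].
Qed.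

Lemma borel_on0 : borel_on B set0.
Proof. by split; [exact: measurable0|exact: sub0set]. Qed.

(** The values lie in an arbitrary [zmodType] so that the notion covers both the real-valued [leb]
    and set functions valued in random variables. *)
Definition additive_on (V : zmodType) (phi : set R -> V) :=
  forall A A', borel_on B A -> borel_on B A' -> A `&` A' = set0 ->
    phi (A `|` A') = phi A + phi A'.

Lemma additive_on_bigsetU (V : zmodType) (phi : set R -> V) (A : nat -> set R) n :
  additive_on V phi -> (forall i, borel_on B (A i)) -> trivIset setT A ->
  borel_on B (\big[setU/set0]_(i < n) A i) /\
  phi (\big[setU/set0]_(i < n) A i) = \sum_(i < n) phi (A i).
Proof.
move=> addphi BA tA; elim: n => [|n [IH1 IH2]].
  rewrite !big_ord0; split; first exact: borel_on0.
  (* Splitting the empty set into two empty sets gives [phi set0 = phi set0 + phi set0], hence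
     [phi set0 = 0]. *)
  have := addphi _ _ borel_on0 borel_on0 (setI0 _); rewrite setU0 => /eqP.
  by rewrite -subr_eq0 opprD addNKr oppr_eq0 => /eqP.
rewrite !big_ord_recr/=; split; first exact: borel_onU.
rewrite addphi// ?IH2//.
rewrite big_distrl/= big1// => i _.
by move/trivIsetP : tA; apply => //; rewrite ltn_eqF.
Qed.

(** The union splits into its first [n] sets and the remainder. The error in countable additivity
    thus becomes the value of [phi] on the remainder, which can be bounded through its Lebesgue
    measure. *)
Lemma additive_on_tail (V : zmodType) (phi : set R -> V) (A : nat -> set R) n :
  additive_on V phi -> (forall i, borel_on B (A i)) -> trivIset setT A ->
  phi (\bigcup_i A i `\` \big[setU/set0]_(i < n) A i) =
  phi (\bigcup_i A i) - \sum_(i < n) phi (A i).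
Proof.
move=> addphi BA tA.
have [BU <-] := additive_on_bigsetU V phi A n addphi BA tA.
have BUA : borel_on B (\bigcup_i A i).
  split; first by apply: bigcup_measurable => k _; have [] := BA k.
  by apply: bigcup_sub => k _; have [] := BA k.
set U := \bigcup_i A i in BUA *; set W := \big[setU/set0]_(i < n) A i in BU *.
have WU : W `<=` U by rewrite /W -bigcup_mkord; exact: bigcup_subset.
rewrite -[in RHS](setDUK WU) addphi//; last 2 first.
- exact: borel_onD.
- by rewrite setDIK.
by rewrite [in RHS]addrAC subrr add0r.
Qed.

Hypothesis finB : (lebesgue_measure B < +oo)%E.
Hypothesis mB : measurable B.

Lemma leb_fin {A} : borel_on B A -> (leb A)%:E = lebesgue_measure A.
Proof.
move=> [mA AB]; rewrite /leb fineK// ge0_fin_numE//.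
by apply: le_lt_trans finB; apply: le_measure => //; rewrite inE.
Qed.

Lemma leb_le {A} : borel_on B A -> 0 <= leb A <= leb B.
Proof.
move=> BA; apply/andP; split; first by rewrite /leb fine_ge0.
rewrite -lee_fin !leb_fin//; last by split.
by case: BA => mA AB; apply: le_measure => //; rewrite inE.
Qed.

Lemma leb_additive : additive_on _ (@leb R).
Proof.
move=> A A' BA BA' AA'; apply: EFin_inj; rewrite EFinD !leb_fin//; last first.
  exact: borel_onU.
by rewrite measureU//; [case: BA|case: BA'].
Qed.

(** Countable additivity of Lebesgue measure, where the limit is finite because the union lies in
    [B]; finiteness allows the passage from extended reals to reals and the subtraction. *)
Lemma leb_tail_cvg (A : nat -> set R) :
  (forall i, borel_on B (A i)) -> trivIset setT A ->
  leb (\bigcup_i A i `\` \big[setU/set0]_(i < n) A i) @[n --> \oo] --> (0 : R).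
Proof.
move=> BA tA.
have BUA : borel_on B (\bigcup_i A i).
  split; first by apply: bigcup_measurable => k _; have [] := BA k.
  by apply: bigcup_sub => k _; have [] := BA k.
under eq_fun do rewrite (additive_on_tail _ _ _ _ leb_additive BA tA).
suff: (leb (\bigcup_i A i) - \sum_(i < n) leb (A i)) @[n --> \oo] -->
  leb (\bigcup_i A i) - leb (\bigcup_i A i) by rewrite subrr.
apply: cvgB; first exact: cvg_cst.
have mA i : measurable (A i) by case: (BA i).
have : (\sum_(0 <= i < n) lebesgue_measure (A i))%E @[n --> \oo] -->
    (leb (\bigcup_i A i))%:E.
  rewrite (leb_fin BUA).
  have h := @measure_semi_sigma_additive _ (measurableTypeR R) R
    lebesgue_measure A mA tA BUA.1.
  exact: h.
move=> /fine_cvgP[_]; apply: cvg_trans.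
apply: near_eq_cvg; near=> n => /=.
rewrite big_mkord -[RHS]/(fine (\sum_(i < n) leb (A i))%:E) -sumEFin.
by congr fine; apply: eq_bigr => i _; rewrite leb_fin.
Unshelve. all: by end_near. Qed.

End borel_on.

(** For [A] inside [B], this is [\1_A] minus its conditional expectation given the sigma-algebra
    generated by [B]. As with a Brownian bridge, the total over [B] is pinned to zero. The quotient
    is meaningful only for [mu B] nonzero. *)
Definition bridge {d : measure_display} {S : measurableType d} {R : realType}
    (mu : probability S R) (B A : set S) : S -> R :=
  \1_A \- (fine (mu A) / fine (mu B)) \o* \1_B.

(** * Moments and additivity of the bridge *)

Section bridge.
Context {d : measure_display} {S : measurableType d} {R : realType}.
Context {mu : probability S R}.

Let indic1 {A : set S} : measurable A -> \1_A \in Lfun mu 1.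
Proof. by move=> mA; exact: Lfun_indic. Qed.

Let scale1 {A : set S} (c : R) : measurable A -> c \o* \1_A \in Lfun mu 1.
Proof. by move=> mA; apply: Lfun21; apply: Lfun2_scale; exact: Lfun_indic. Qed.

Let muE {A : set S} : measurable A -> mu A = (fine (mu A))%:E.
Proof. by move=> mA; rewrite fineK// fin_num_measure. Qed.

Lemma Lfun_bridge {B A : set S} : measurable B -> measurable A ->
  bridge mu B A \in Lfun mu 2%:E.
Proof.
move=> mB mA; apply: Lfun2B; first exact: Lfun_indic.
by apply: Lfun2_scale; exact: Lfun_indic.
Qed.

Lemma expectation_bridge {B A : set S} :
  measurable B -> measurable A -> fine (mu B) != 0 ->
  'E_mu[bridge mu B A]%E = 0%E.
Proof.
move=> mB mA B0; rewrite /bridge expectationB ?indic1 ?scale1//.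
rewrite expectationZl ?indic1// !expectation_indic//.
rewrite [X in (X - _)%E]muE// [X in (_ * X)%E]muE// -EFinM -EFinB.
by congr (_%:E); field.
Qed.

(** Both functions are centred, so the covariance is the mean of their product. As [A] and [A'] lie
    in [B], that product is a linear combination of the indicators of [A & A'], [A], [A'] and
    [B]. *)
Lemma covariance_bridge {B A A' : set S} :
  measurable B -> measurable A -> measurable A' -> fine (mu B) != 0 ->
  A `<=` B -> A' `<=` B ->
  covariance mu (bridge mu B A) (bridge mu B A') =
  (fine (mu (A `&` A')) - fine (mu A) * fine (mu A') / fine (mu B))%:E.
Proof.
move=> mB mA mA' B0 AB AB'; have mAA' : measurable (A `&` A') by exact: measurableI.
rewrite covarianceE2 ?Lfun_bridge// !expectation_bridge// mule0 sube0.
set u := fine (mu A); set u' := fine (mu A'); set b := fine (mu B) in B0 *.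
rewrite (_ : _ \* _ = ((\1_(A `&` A') \- (u' / b) \o* \1_A) \-
  ((u / b) \o* \1_A' \- (u * u' / b ^+ 2) \o* \1_B))); last first.
  apply/funext => x; rewrite /bridge/= !indicE in_setI -/u -/u' -/b.
  have AxB : x \in A -> x \in B by move=> /set_mem/AB/mem_set.
  have AxB' : x \in A' -> x \in B by move=> /set_mem/AB'/mem_set.
  move: AxB AxB'.
  (* Of the eight membership patterns, the three with [x] in [A] or [A'] but not in [B] are
     contradictory. *)
  by case: (x \in A); case: (x \in A'); case: (x \in B) => /= h h';
    [field|have := h isT|field|have := h isT|field|have := h' isT|field|field].
rewrite !expectationB ?Lfun1B ?indic1 ?scale1// !expectationZl ?indic1//.
rewrite !expectation_indic// (muE mA) (muE mA') (muE mB) (muE mAA').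
rewrite -/u -/u' -/b -!EFinM -!EFinB.
by congr (_%:E); field.
Qed.

(** Each bridge vanishes off its own set [B] or [C], so the product of these centred functions is
    zero pointwise. *)
Lemma covariance_bridge_disjoint {B C A D : set S} :
  measurable B -> measurable C -> measurable A -> measurable D ->
  fine (mu B) != 0 -> fine (mu C) != 0 ->
  B `&` C = set0 -> A `<=` B -> D `<=` C ->
  covariance mu (bridge mu B A) (bridge mu C D) = 0%E.
Proof.
move=> mB mC mA mD B0 C0 BC AB DC.
rewrite covarianceE2 ?Lfun_bridge// !expectation_bridge// mule0 sube0.
rewrite (_ : _ \* _ = cst 0) ?expectation_cst//.
apply/funext => x; rewrite /bridge/= !indicE.
have [xB|xB] := boolP (x \in B).
  have xC : x \notin C.
    apply/negP => xC; have : (B `&` C) x by split; exact: set_mem.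
    by rewrite BC.
  have xD : x \notin D by apply: contraNN xC => /set_mem/DC /mem_set.
  by rewrite (negbTE xC) (negbTE xD) mul0r subr0 mulr0.
have xA : x \notin A by apply: contraNN xB => /set_mem/AB /mem_set.
by rewrite (negbTE xA) mul0r subr0 mul0r.
Qed.

Lemma bridgeU {B A A' : set S} : measurable A -> measurable A' ->
  A `&` A' = set0 -> bridge mu B (A `|` A') = bridge mu B A \+ bridge mu B A'.
Proof.
move=> mA mA' AA'; apply/funext => x; rewrite /bridge/=.
rewrite measureU// fineD ?fin_num_measure// !indicE in_setU.
have : ~~ ((x \in A) && (x \in A')).
  by rewrite -in_setI AA' in_set0.
by case: (x \in A); case: (x \in A') => //= _; ring.
Qed.

Lemma bridge_id {B : set S} : fine (mu B) != 0 -> bridge mu B B = cst 0.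
Proof.
by move=> B0; apply/funext => x; rewrite /bridge/= divff// mulr1 subrr.
Qed.

End bridge.

(** The error in countable additivity is [Phi] of the remainder set, whose second moment is at most
    [K] times its Lebesgue measure; this tends to zero. *)
Lemma second_order_random_measure_additive {R : realType} {B : set R}
    {d : measure_display} {Omega : measurableType d} (P : probability Omega R)
    (Phi : set R -> Omega -> R) (K : R) :
  measurable B -> (lebesgue_measure B < +oo)%E ->
  (forall A, borel_on B A -> Phi A \in Lfun P 2%:E) ->
  @additive_on R B (Omega -> R) Phi ->
  (forall A, borel_on B A -> ('E_P[Phi A \* Phi A] <= (K * leb A)%:E)%E) ->
  second_order_random_measure (borel_on B) P Phi.
Proof.
move=> mB finB Phi2 addPhi PhiK; split=> //.
  apply: aeW => w.
  (* [Phi set0 = 0] is finite additivity for a family of length zero. *)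
  have := additive_on_bigsetU (Omega -> R) Phi (fun=> set0) 0 addPhi.
  rewrite !big_ord0 => -[] // ; [by move=> _; exact: borel_on0|..].
    by apply/trivIsetP => i j _ _ _; rewrite setI0.
  by move=> _ ->.
move=> A BA tA.
have BUA : borel_on B (\bigcup_i A i).
  split; first by apply: bigcup_measurable => k _; have [] := BA k.
  by apply: bigcup_sub => k _; have [] := BA k.
apply: (@squeeze_cvge _ _ _ _ (cst 0%E) _
  (fun n => (K * leb (\bigcup_i A i `\` \big[setU/set0]_(i < n) A i))%:E)).
- near=> n; apply/andP; split.
    by apply: expectation_ge0 => w; exact: sqr_ge0.
  have BR : borel_on B (\bigcup_i A i `\` \big[setU/set0]_(i < n) A i).
    apply: borel_onD => //.
    by have [] := additive_on_bigsetU _ Phi A n addPhi BA tA.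
  apply: le_trans (PhiK _ BR); rewrite (additive_on_tail _ _ _ _ addPhi BA tA).
  rewrite le_eqVlt; apply/orP; left; apply/eqP; congr (expectation P).
  apply/funext => w; rewrite -normrX ger0_norm ?sqr_ge0//= expr2.
  by congr (_ * _); rewrite !fctE fct_sumE.
- exact: cvg_cst.
- apply: cvg_EFin; first exact: nearW.
  rewrite -[0](mulr0 K); apply: cvgM; first exact: cvg_cst.
  exact: (leb_tail_cvg finB mB).
Unshelve. all: by end_near. Qed.

(** * Construction of the random measures on the product space *)

Theorem mainTheorem3 (R : realType) (T : nat) (lambda : R) (s : nat -> R)
    (d : measure_display) (Omega : measurableType d) (P : probability Omega R)
    (X : nat -> Omega -> R)
    (T_pos : (0 < T)%N)
    (lambda01 : 0 <= lambda <= 1)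
    (s0 : s 0%N = 0)
    (s_incr : forall j, s j < s j.+1)
    (s_cover : \bigcup_(j in [set j | (0 < j)%N]) block s j = [set` `]0, +oo[])
    (s_period : forall j k, (0 < j)%N -> (0 < k)%N ->
       lebesgue_measure (block s j) = lebesgue_measure (block s (j + k * T)%N))
    (X_pos : positive_process P X)
    (X_L2 : second_order_process P X)
    (X_pc : periodically_correlated P T X) :
  let B := block s in
  let a j := leb (B j) in
  let gamma j k := covariance P (X j) (X k) in
  exists (d' : measure_display) (Omega' : measurableType d')
    (P' : probability Omega' R) (p : Omega' -> Omega)
    (M : nat -> set R -> Omega' -> R),
  [/\ probability_extension P P' p,
      forall j, (0 < j)%N ->
        [/\ second_order_random_measure (borel_on (B j)) P' (M j),
            {ae P', forall w, M j (B j) w = X j (p w)},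
            forall A, borel_on (B j) A ->
              ('E_P'[M j A] = (leb A / leb (B j))%:E * 'E_P[X j])%E &
            forall A A', borel_on (B j) A -> borel_on (B j) A' ->
              covariance P' (M j A) (M j A') =
              (((lambda * leb A * leb A' + (1 - lambda) * a j * leb (A `&` A'))
                 / a j ^+ 2)%:E * gamma j j)%E] &
      forall j k, (0 < j)%N -> (0 < k)%N -> k != j ->
        forall A D, borel_on (B j) A -> borel_on (B k) D ->
          covariance P' (M j A) (M k D) =
          ((leb A * leb D / (a j * a k))%:E * gamma j k)%E].
Proof.
move=> B a gamma.
have mB j : measurable (B j) := measurable_block j.
have BB j : borel_on (B j) (B j) by split.
have lB j : (0 < j)%N -> (0 < lebesgue_measure (B j) < +oo)%E.
  exact: lebesgue_block.
have finB j : (0 < j)%N -> (lebesgue_measure (B j) < +oo)%E.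
  by move=> /lB/andP[].
have a0 j : (0 < j)%N -> 0 < a j by move=> /lB; exact: fine_gt0.
have BD j k : (0 < j)%N -> (0 < k)%N -> k != j -> B j `&` B k = set0.
  exact: block_disjoint.
have tB : trivIset setT (fun k => B k.+1).
  by apply/trivIsetP => i j _ _ ij; apply: BD; rewrite // eq_sym.
(* The shift to [B k.+1] matches families indexed from 0 with blocks indexed from 1, so block [j]
   receives mass [2 ^- j]. *)
have [mu muB] := @exists_blockwise_probability _ (measurableTypeR R) R
  lebesgue_measure (fun k => B k.+1) (fun k => mB k.+1) tB
  (fun k => lB k.+1 isT).
(* The density of [mu] with respect to Lebesgue measure on [B j]; thus [q j * a j] is the mass of
   [B j]. *)
pose q j : R := 1 / (2 ^ j)%:R / a j.
have q0 j : (0 < j)%N -> 0 < q j.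
  by move=> j0; rewrite !divr_gt0 ?a0// ltr0n expn_gt0.
have muE j A : (0 < j)%N -> borel_on (B j) A -> fine (mu A) = q j * leb A.
  case: j => // j _ BA; rewrite (muB j A BA.1 BA.2).
  transitivity (fine ((q j.+1)%:E * (leb A)%:E)%E); last by [].
  congr (fine (_ * _)%E).
  exact: esym (leb_fin (finB j.+1 isT) (mB j.+1) BA).
have muB0 j : (0 < j)%N -> fine (mu (B j)) != 0.
  by move=> j0; rewrite (muE j)// mulf_neq0// gt_eqF ?q0//; exact: a0.
pose v j := fine (gamma j j).
have gfin j k : (0 < j)%N -> (0 < k)%N -> gamma j k \is a fin_num.
  by move=> j0 k0; exact: covariance_fin2 (X_L2 _ j0) (X_L2 _ k0).
have v0 j : 0 <= v j by apply: fine_ge0; exact: variance_ge0.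
pose c j := Num.sqrt ((1 - lambda) * v j / (q j * a j)).
(* [Num.sqrt] returns 0 on negative numbers, so the radicand must be nonnegative: this uses
   [lambda <= 1] and that [v j] is a variance. *)
have c2 j : (0 < j)%N -> c j * c j = (1 - lambda) * v j / (q j * a j).
  move=> j0; rewrite -expr2 sqr_sqrtr//; case/andP: lambda01 => _ lambda1.
  apply: divr_ge0; apply: mulr_ge0; rewrite ?subr_ge0 ?v0//.
  - exact: ltW (q0 _ j0).
  - exact: ltW (a0 _ j0).
pose P' : probability _ R := (P \x mu)%E.
have ext1 : probability_extension P P' fst by exact: probability_extension_fst.
have ext2 : probability_extension mu P' snd by exact: probability_extension_snd.
pose M j A := (leb A / a j) \o* (X j \o fst) \+ c j \o* (bridge mu (B j) A \o snd).
have X2 j : (0 < j)%N -> X j \o fst \in Lfun P' 2%:E.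
  move=> j0; exact (Lfun_comp ext1 (X_L2 _ j0)).
have W2' j A : borel_on (B j) A -> bridge mu (B j) A \in Lfun mu 2%:E.
  by move=> BA; exact (Lfun_bridge (mu := mu) (mB j) BA.1).
have W2 j A : borel_on (B j) A -> bridge mu (B j) A \o snd \in Lfun P' 2%:E.
  by move=> BA; exact (Lfun_comp ext2 (W2' _ _ BA)).
have M2 j A : (0 < j)%N -> borel_on (B j) A -> M j A \in Lfun P' 2%:E.
  by move=> j0 BA; exact (Lfun_lincomb _ _ (X2 _ j0) (W2 _ _ BA)).
(* One formula for equal and for distinct blocks; the two cases differ only in the covariance of the
   bridges. *)
have covM j k A D : (0 < j)%N -> (0 < k)%N -> borel_on (B j) A ->
    borel_on (B k) D -> covariance P' (M j A) (M k D) =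
    ((leb A / a j * (leb D / a k))%:E * gamma j k +
     (c j * c k)%:E * covariance mu (bridge mu (B j) A) (bridge mu (B k) D))%E.
  move=> j0 k0 BA BkD; rewrite covariance_lincomb ?X2 ?W2//.
  - by rewrite (covariance_comp ext1 (X_L2 _ j0) (X_L2 _ k0))
      (covariance_comp ext2 (W2' _ _ BA) (W2' _ _ BkD)).
  - by apply: covariance_fst_snd; [exact: X_L2|exact: W2'].
  - by apply: covariance_fst_snd; [exact: X_L2|exact: W2'].
have covMjj j A A' : (0 < j)%N -> borel_on (B j) A -> borel_on (B j) A' ->
    covariance P' (M j A) (M j A') =
    (((lambda * leb A * leb A' + (1 - lambda) * a j * leb (A `&` A'))
       / a j ^+ 2)%:E * gamma j j)%E.
  move=> j0 BA BA'; have BAA' := borel_onI _ _ BA BA'.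
  rewrite covM// (covariance_bridge (mu := mu) (mB j) BA.1 BA'.1 (muB0 _ j0)
    BA.2 BA'.2).
  rewrite !(muE j)// -(fineK (gfin _ _ j0 j0)) -/(v j) c2// -/(a j).
  (* The first factor contributes [|A| |A'| / a_j ^ 2] with weight 1 and the bridge with weight
     [-(1 - lambda)], which leaves [lambda]. *)
  rewrite -!EFinM -EFinD; congr (_%:E).
  have := q0 _ j0; have := a0 _ j0 => /lt0r_neq0 ? /lt0r_neq0 ?; field.
  by apply/andP; split; assumption.
have EM j A : (0 < j)%N -> borel_on (B j) A ->
    ('E_P'[M j A] = (leb A / leb (B j))%:E * 'E_P[X j])%E.
  move=> j0 BA; have X1 := Lfun21 (X2 _ j0); have W1 := Lfun21 (W2 _ _ BA).
  rewrite /M expectationD ?Lfun21 ?Lfun2_scale ?X2 ?W2//.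
  rewrite (expectationZl _ X1) (expectationZl _ W1).
  rewrite (expectation_comp ext1 (Lfun21 (X_L2 _ j0))).
  rewrite (expectation_comp ext2 (Lfun21 (W2' _ _ BA))).
  by rewrite (expectation_bridge (mu := mu) (mB j) BA.1 (muB0 _ j0)) mule0 adde0.
exists _, _, P', fst, M; split=> //.
- move=> j j0; split; [|..|by move=> A; exact: EM|by move=> A A'; exact: covMjj].
  + pose e := fine 'E_P[X j]%E.
    have eE : 'E_P[X j]%E = e%:E.
      by rewrite fineK// expectation_fin_num// Lfun21// X_L2.
    (* The constant is the second moment of [X j] divided by the length of the block. *)
    apply: (@second_order_random_measure_additive R (B j) _ _ P' (M j)
      ((v j + e ^+ 2) / a j)) => //.
    * exact: finB.
    * by move=> A; exact: M2.
    * move=> A A' BA BA' AA'; rewrite /M (leb_additive (finB _ j0))//.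
      rewrite (bridgeU (mu := mu) BA.1 BA'.1 AA'); apply/funext => w /=.
      rewrite -[RHS]/(_ + _ + (_ + _)).
      by rewrite /=; ring.
    * move=> A BA.
      (* The second moment of [M j A] is its variance plus its squared mean, both already
         computed. *)
      have := covarianceE2 (M2 _ _ j0 BA) (M2 _ _ j0 BA).
      rewrite covMjj// EM// eE setIid -(fineK (gfin _ _ j0 j0)) -/(v j) -!EFinM.
      have Efin : 'E_P'[M j A \* M j A]%E \is a fin_num.
        by rewrite expectation_fin_num// Lfun2_mul_Lfun1// M2.
      rewrite -(fineK Efin) -EFinB => hE; have {hE} h := congr1 fine hE.
      rewrite /= in h; rewrite lee_fin.
      have /andP[l0 la] := leb_le (finB _ j0) (mB j) BA.
      rewrite -/(a j) in la h.
      have aj := a0 _ j0; have vj := v0 j; case/andP: lambda01 => lam0 lam1.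
      set E := fine _ in h *; set l := leb A in h l0 la *.
      have -> : E = (lambda * l * l + (1 - lambda) * a j * l) / a j ^+ 2 * v j +
         l / a j * e * (l / a j * e) by rewrite h; ring.
      (* The bound is split into a variance and a mean part over the same denominators, so that the
         two sides compare term by term. *)
      have -> : (v j + e ^+ 2) / a j * l = (a j * l) / a j ^+ 2 * v j +
         (a j * l) / a j ^+ 2 * e ^+ 2 by field; rewrite gt_eqF.
      rewrite (_ : l / a j * e * _ = l * l / a j ^+ 2 * e ^+ 2); last first.
        by field; rewrite gt_eqF.
      have ll : l * l <= a j * l by exact: ler_wpM2r.
      apply: lerD; apply: ler_wpM2r; rewrite ?sqr_ge0//; apply: ler_wpM2r;
        rewrite ?invr_ge0 ?sqr_ge0//.
      (* A convex combination of [l * l] and [a j * l] is at most the larger of them, [a j * l]. *)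
      rewrite -!mulrA; nra.
  (* At [A = B j] the bridge is identically zero and the coefficient of [X j] is 1, so equality
     holds everywhere. *)
  + apply: aeW => w; rewrite /M/= bridge_id ?muB0//= divff ?mulr1 ?mul0r ?addr0//.
    by rewrite gt_eqF// a0.
- move=> j k j0 k0 kj A D BA BkD.
  rewrite covM// (covariance_bridge_disjoint (mu := mu) (mB j) (mB k)
    BA.1 BkD.1 (muB0 _ j0) (muB0 _ k0) (BD _ _ j0 k0 kj) BA.2 BkD.2).
  by rewrite mule0 adde0; congr (_%:E * _)%E; rewrite invfM mulrACA.
Qed.
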